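(* Let $m\ge1$ be odd, let $V_1,\dots,V_m$ be two-dimensional vector spaces over $\mathbb{F}_2$, and let $W_k=\mathbb{F}_4\otimes_{\mathbb{F}_2}V_k$. Then the complex-conjugate subspaces $\mathrm{span}\,\mathcal{B}_m^+$ and $\mathrm{span}\,\mathcal{B}_m^-$ of $\mathbb{P}\big(\bigotimes_{k=1}^mW_k\big)$ are indicator sets of a $G_{\mathcal{S}_{(m)}(2)}$-invariant geometric line spread $\mathcal{L}$ of $\mathbb{P}\big(\bigotimes_{k=1}^mV_k\big)=\mathrm{PG}(2^m-1,2)$. All distinguished tangents of the Segre variety $\mathcal{S}_{(m)}(2)$ and all lines $\mathbb{F}_4U_i\vee\mathbb{F}_4U_{i'}$ with $i=(i_1,\dots,i_m)\in\{0,1\}^m$, $i_1=0$, belong to this spread.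
   Context: $\mathbb{P}(V)$ is the projective space of one-dimensional subspaces of $V$. The Segre variety is $\mathcal{S}_{(m)}(2)=\{\mathbb{F}_2(a_1\otimes\cdots\otimes a_m)\mid a_k\in V_k\setminus\{0\}\}\subset\mathbb{P}\big(\bigotimes_k V_k\big)$; $G_{\mathcal{S}_{(m)}(2)}$ is the group of all elements of $\mathrm{PGL}\big(\bigotimes_k V_k\big)$ mapping it onto itself. $\mathbb{F}_4=\{0,1,\omega,\omega^2\}$ with $\omega^2+\omega+1=0$. We regard $V_k\subset W_k$ via $a\mapsto1\otimes a$ and identify $\mathbb{F}_4\otimes_{\mathbb{F}_2}\bigotimes_kV_k$ with $\bigotimes_kW_k$, so $\mathbb{P}(\bigotimes_kV_k)\subset\mathbb{P}(\bigotimes_kW_k)=\mathrm{PG}(2^m-1,4)$. Complex conjugation on $\bigotimes_kW_k$ is the map induced by the Frobenius $z\mapsto z^2$ on $\mathbb{F}_4$ fixing $\bigotimes_kV_k$ elementwise. A point is real if it lies in $\mathbb{P}(\bigotimes_kV_k)$; a subspace of $\mathbb{P}(\bigotimes_kW_k)$ is real if it equals its complex-conjugate subspace. A line of $\mathbb{P}(\bigotimes_kV_k)$ is identified with the real line of $\mathbb{P}(\bigotimes_kW_k)$ that it spans. $\vee$ denotes join of points, and spans are taken over $\mathbb{F}_4$. For each $k$ fix a basis $(e_0^{(k)},e_1^{(k)})$ of $V_k$ and put $u_0^{(k)}=e_0^{(k)}+\omega e_1^{(k)}$, $u_1^{(k)}=e_0^{(k)}+\omega^2e_1^{(k)}$.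 For $i\in\{0,1\}^m$ let $U_i=u_{i_1}^{(1)}\otimes\cdots\otimes u_{i_m}^{(m)}$, and let $i'$ be the opposite multi-index ($i'_k\ne i_k$ for all $k$). $\mathcal{B}_m^+$ (resp. $\mathcal{B}_m^-$) is the set of points $\mathbb{F}_4U_i$ for which $i$ has an even (resp. odd) number of entries equal to $1$. Line spread: a set of lines of $\mathbb{P}(\bigotimes_kV_k)$ such that each point is on exactly one of them; it is geometric if for any two distinct lines of the spread, the lines of the spread contained in their span form a spread of that span. The two skew complex-conjugate subspaces are called indicator sets of the spread if the spread comprises exactly all real lines which meet one of these subspaces (and hence both of them, in complex-conjugate points). Distinguished tangents: through each point $p=\mathbb{F}_2(a_1\otimes\cdots\otimes a_m)$ of $\mathcal{S}_{(m)}(2)$ there are exactly $m$ generators, namely the lines $\{\mathbb{F}_2(a_1\otimes\cdots\otimes a_{k-1}\otimes x\otimes a_{k+1}\otimes\cdots\otimes a_m)\mid x\in V_k\setminus\{0\}\}$, $k=1,\dots,m$. They span the ($m$-dimensional) tangent space at $p$; the tangent lines at $p$ are the lines of $\mathbb{P}(\bigotimes_kV_k)$ through $p$ contained in this tangent space. Precisely one tangent line at $p$ does not lie in any of the $(m-1)$-dimensional subspaces spanned by $m-1$ of the generators through $p$; it is called the distinguished tangent at $p$. *)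

(* Defs.v *)
From HB Require Import structures.
From mathcomp Require Import all_boot all_order all_algebra all_field.

Set Implicit Arguments.
Unset Strict Implicit.
Unset Printing Implicit Defensive.

Import GRing.Theory.
Local Open Scope ring_scope.

(** Tensor products and extensions of scalars are not fixed to a particular
    model: they are characterised by their universal properties among
    finite-dimensional vector spaces. *)

Section TensorProduct.
Variables (F : fieldType) (m : nat) (V : 'I_m -> vectType F).

(** [dfwith a x], with [x : V k], is the family [a] with its [k]-th entry
    replaced by [x]. *)
Definition multilinear (U : vectType F) (f : (forall k, V k) -> U) : Prop :=
  forall (a : forall k, V k) (k : 'I_m), linear (fun x : V k => f (dfwith a x)).

Definition is_tensor_product (T : vectType F) (tens : (forall k, V k) -> T) :
    Prop :=
  multilinear tens /\
  forall (U : vectType F) (f : (forall k, V k) -> U), multilinear f ->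
    exists! g : 'Hom(T, U), forall a, g (tens a) = f a.

End TensorProduct.

Definition is_scalar_extension (K : fieldType) (L : fieldExtType K)
    (V : vectType K) (W : vectType L) (iota : V -> W) : Prop :=
  linear_for (in_alg L \; *:%R) iota /\
  forall (U : vectType L) (f : V -> U), linear_for (in_alg L \; *:%R) f ->
    exists! g : 'Hom(W, U), forall v, g (iota v) = f v.

(** The subspaces of the projective space on [T] are the elements of
    [{vspace T}], of vector dimension one more than their projective
    dimension; a set of subspaces is a predicate. *)

Section ProjectiveSpace.
Variables (F : fieldType) (T : vectType F).
Implicit Types A B p l : {vspace T}.

Definition point p : Prop := \dim p = 1%N.
Definition line l : Prop := \dim l = 2%N.
Definition skew A B : Prop := (A :&: B)%VS = 0%VS.
Definition meets A B : Prop := exists p, [/\ point p, (p <= A)%VS & (p <= B)%VS].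

(** Elements of PGL, as maps on subspaces: representatives that differ by a
    scalar give the same map. *)
Definition PGL (phi : {vspace T} -> {vspace T}) : Prop :=
  exists2 g : 'End(T), lker g = 0%VS & forall A, phi A = (g @: A)%VS.

Definition line_spread (A : {vspace T}) (Ls : {vspace T} -> Prop) : Prop :=
  (forall l, Ls l -> line l /\ (l <= A)%VS) /\
  (forall p, point p -> (p <= A)%VS -> exists! l, Ls l /\ (p <= l)%VS).

Definition geometric_line_spread (Ls : {vspace T} -> Prop) : Prop :=
  line_spread fullv Ls /\
  forall l1 l2, Ls l1 -> Ls l2 -> l1 <> l2 ->
    line_spread (l1 + l2)%VS (fun l => Ls l /\ (l <= l1 + l2)%VS).

End ProjectiveSpace.

Section Segre.
Variables (F : fieldType) (m : nat) (V : 'I_m -> vectType F) (T : vectType F).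
Variable tens : (forall k, V k) -> T.

Definition segre (p : {vspace T}) : Prop :=
  exists2 a : forall k, V k, forall k, a k != 0 & p = <[tens a]>%VS.

Definition segre_group (phi : {vspace T} -> {vspace T}) : Prop :=
  PGL phi /\ forall p, segre p <-> exists2 q, segre q & p = phi q.

(** For a multilinear [tens], the set of all [tens (dfwith a x)], [x : V k],
    is already a subspace. *)
Definition segre_generator (a : forall k, V k) (k : 'I_m) : {vspace T} :=
  <<[seq tens (dfwith a x) | x <- vbasis {: V k}]>>%VS.

Definition tangent_space (a : forall k, V k) : {vspace T} :=
  (\sum_(k < m) segre_generator a k)%VS.

Definition tangent_line (a : forall k, V k) (l : {vspace T}) : Prop :=
  [/\ line l, (<[tens a]> <= l)%VS & (l <= tangent_space a)%VS].

Definition distinguished_tangent_at (a : forall k, V k) (l : {vspace T}) :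
    Prop :=
  tangent_line a l /\
  forall j : 'I_m, ~~ (l <= \sum_(k < m | k != j) segre_generator a k)%VS.

Definition distinguished_tangent (l : {vspace T}) : Prop :=
  exists2 a : forall k, V k,
    forall k, a k != 0 & distinguished_tangent_at a l.

End Segre.

Section RealStructure.
Variables (K : fieldType) (F4 : fieldExtType K).
Variables (T : vectType K) (TW : vectType F4).
Variables (J : T -> TW) (conj : TW -> TW).

(** [TW] is the space [F4 (x) T] and [J] maps [t] to [1 (x) t]. *)
Definition is_complex_conjugation : Prop :=
  (forall c u v, conj (c *: u + v) = c ^+ 2 *: conj u + conj v) /\
  (forall t, conj (J t) = J t).

(** The image of a subspace under the semilinear map [conj] is spanned by the
    image of a basis. *)
Definition conj_space (A : {vspace TW}) : {vspace TW} :=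
  <<[seq conj w | w <- vbasis A]>>%VS.

Definition real_line (X : {vspace TW}) : Prop := line X /\ conj_space X = X.

(** The subspace of [TW] spanned over [F4] by a subspace of [T]. *)
Definition complexify (A : {vspace T}) : {vspace TW} :=
  <<[seq J t | t <- vbasis A]>>%VS.

Definition indicator_sets (Ls : {vspace T} -> Prop) (A B : {vspace TW}) :
    Prop :=
  [/\ skew A B,
      conj_space A = B,
      forall X, (exists2 l, Ls l & X = complexify l) <->
                (real_line X /\ meets X A),
      forall X, (exists2 l, Ls l & X = complexify l) <->
                (real_line X /\ meets X B)
    & forall l, Ls l ->
        exists p, [/\ point p, (complexify l :&: A)%VS = p
                    & (complexify l :&: B)%VS = conj_space p]].

End RealStructure.

Section TensorBasis.
Variables (F4 : fieldType) (m : nat) (W : 'I_m -> vectType F4).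
Variables (TW : vectType F4) (tens : (forall k, W k) -> TW).
Variables (omega : F4) (e0 e1 : forall k, W k).

(** The entries [0] and [1] of a multi-index are encoded by [false] and
    [true]. *)
Definition u_vec (b : bool) (k : 'I_m) : W k :=
  e0 k + (if b then omega ^+ 2 else omega) *: e1 k.

Definition U_vec (i : {ffun 'I_m -> bool}) : TW :=
  tens (fun k => u_vec (i k) k).

Definition opposite (i : {ffun 'I_m -> bool}) : {ffun 'I_m -> bool} :=
  [ffun k => ~~ i k].

Definition span_B_plus : {vspace TW} :=
  (\sum_(i : {ffun 'I_m -> bool} | ~~ odd #|[set k | i k]|) <[U_vec i]>)%VS.

Definition span_B_minus : {vspace TW} :=
  (\sum_(i : {ffun 'I_m -> bool} | odd #|[set k | i k]|) <[U_vec i]>)%VS.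

End TensorBasis.

(* Main.v *)
Require Import Defs.
From HB Require Import structures.
From mathcomp Require Import all_boot all_order all_algebra all_field.
From mathcomp Require Import ring.
From Stdlib Require Import FunctionalExtensionality.

Set Implicit Arguments.
Unset Strict Implicit.
Unset Printing Implicit Defensive.

Import GRing.Theory.
Local Open Scope ring_scope.

(** Write T for the tensor product of the planes V_k over F_2 and TW for that
    of the W_k over F_4.  The spread comes from a structure of F_4-vector space
    on T: an endomorphism s with s^2 + s + 1 = 0 lets a root of x^2 + x + 1 act
    on T, and its one-dimensional F_4-subspaces, the lines through t and s t,
    form a geometric line spread for a formal reason: an s-stable subspace is
    partitioned by the spread lines that it contains, and the span of two
    spread lines is s-stable ([quad_spread_stable]).

    The right s is a sum over the factors.  Let sigma_k act on V_k by
    e0 |-> e1 |-> e0 + e1; it also satisfies x^2 + x + 1 = 0, and over F_4 it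
    has the eigenvectors u_0 and u_1, for omega and omega^2.  Put
    s = sum_k sigma_k, each sigma_k acting on its own factor.  As
    omega^2 = omega + 1, the vector U_i is an eigenvector of the extension S of
    s to TW, for the eigenvalue m omega + #{k | i_k = 1} ([S_U_vec]).  When m
    is odd this is omega or omega^2 according to the parity of i, so that
    span B+ and span B- are exactly the two eigenspaces of S.  The relation
    s^2 + s + 1 = 0 follows, and everything about indicator sets is
    eigenspace bookkeeping: S commutes with conjugation, conjugation therefore
    exchanges the eigenspaces, and the spread line of t becomes, over F_4, the
    join of the two conjugate components x, conj x of t along the eigenspaces
    ([complexify_quad_line]).  Conversely x + conj x is real for every x in
    span B+ ([conj_line_descends]).

    At a pure tensor p the tensor q_k obtained by applying sigma_k to the k-th
    factor is a second point of the k-th generator, and s p is the sum of the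
    q_k.  A tangent line at p outside every space spanned by all generators but
    one has a second point d p + sum_k c_k q_k with all c_k nonzero; over F_2
    this forces it to be the spread line of p ([distinguished_tangentE]).

    For the invariance, the Segre group need not be determined.  Let g be
    linear, injective and map pure tensors to pure tensors.  Two pure tensors
    with a pure sum differ in one factor only ([pure_sum]), so g carries
    the generators on p to those on g p, and each g q_k is one of the q_j of
    g p, up to adding g p; summing over k gives
    g s p = s g p + c(p) g p with c(p) in F_2 ([collineation_eigen]).  By
    linearity c is constant on each generator; as generators connect the Segre
    variety, c is constant and g s = s g + c g on the whole of T
    ([collineation_commute]), which means that g maps spread lines to spread
    lines.

    The tensor products are only known through their universal property.  It is
    used in two forms: a linear map is determined by its values on pure tensors
    (even on tensors of basis vectors), and products of linear forms define
    linear forms on the tensor product. *)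

(** * Semilinear images and line spreads over F_2 *)

(** The form is a coordinate of the component of [x] along a complement of
    [Y], rescaled. *)
Lemma separating_functional (F : fieldType) (V : vectType F) (x : V)
    (Y : {vspace V}) :
  x \notin Y ->
  exists f : 'Hom(V, F^o), f x = 1 /\ (forall y, y \in Y -> f y = 0).
Proof.
move=> xY; pose h : 'End(V) := (\1 - projv Y)%VF.
have hE y : h y = y - projv Y y by rewrite !lfunE /= opp_lfunE lfunE.
have hx : h x != 0.
  by apply: contraNneq xY; rewrite hE => /subr0_eq ->; apply: memv_proj.
have [i ci] : exists i, coord (vbasis {:V}) i (h x) != 0.
  apply/existsP; apply: contraNT hx => /existsPn ci0.
  rewrite (coord_vbasis (memvf (h x))) big1 // => i _.
  by rewrite (eqP (negbNE (ci0 i))) scale0r.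
pose f0 : 'Hom(V, F^o) := linfun (coord (vbasis {:V}) i : V -> F^o).
have f0E y : f0 y = coord (vbasis {:V}) i y by rewrite lfunE.
exists ((coord (vbasis {:V}) i (h x))^-1 *: (f0 \o h))%VF; split=> [|y Yy].
  by rewrite scale_lfunE comp_lfunE f0E -[_ *: _]/(_ * _) mulVf.
by rewrite scale_lfunE comp_lfunE f0E [h y]hE projv_id // subrr linear0 scaler0.
Qed.

Lemma hom_of_basis (F : fieldType) (V U : vectType F) (e0 e1 : V) (x0 x1 : U) :
  basis_of {:V} [:: e0; e1] ->
  exists h : 'Hom(V, U), h e0 = x0 /\ h e1 = x1.
Proof.
case/andP=> _ free_e; have [f] := linear_of_free [:: e0; e1] [:: x0; x1].
case/(_ free_e erefl)=> <- <-; exists (linfun f).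
by rewrite !lfunE.
Qed.

Lemma basis2_expand (F : fieldType) (V : vectType F) (e0 e1 v : V) :
  basis_of {:V} [:: e0; e1] -> exists c0 c1, v = c0 *: e0 + c1 *: e1.
Proof.
move=> e_basis.
have := memvf v; rewrite -(span_basis e_basis) span_cons span_seq1.
by case/memv_addP=> _ /vlineP[c0 ->] [_ /vlineP[c1 ->] ->]; exists c0, c1.
Qed.

Section SemilinearImage.
Variables (F F' : fieldType) (V : vectType F) (W : vectType F').
Variables (theta : F -> F') (f : V -> W).
Hypothesis f_semilinear :
  forall c u v, f (c *: u + v) = theta c *: f u + f v.

Lemma semilinear_sum (I : Type) (r : seq I) (P : pred I) (c : I -> F)
    (v : I -> V) : f 0 = 0 ->
  f (\sum_(i <- r | P i) c i *: v i) =
    \sum_(i <- r | P i) theta (c i) *: f (v i).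
Proof. by move=> f0; elim/big_rec2: _ => // i _ x _ <-; apply: f_semilinear. Qed.

Definition semilinear_image (A : {vspace V}) : {vspace W} :=
  <<[seq f v | v <- vbasis A]>>%VS.

Lemma mem_semilinear_image (A : {vspace V}) v :
  f 0 = 0 -> v \in A -> f v \in semilinear_image A.
Proof.
move=> f0 /coord_vbasis ->; rewrite semilinear_sum //.
apply: rpred_sum => i _; apply: rpredZ; apply: memv_span.
by apply: map_f; rewrite mem_nth // size_tuple.
Qed.

Lemma semilinear_image_sub (A : {vspace V}) (X : {vspace W}) :
  (forall v, v \in A -> f v \in X) -> (semilinear_image A <= X)%VS.
Proof. by move=> fAX; apply/span_subvP => _ /mapP[v /vbasis_mem Av ->]; auto. Qed.

End SemilinearImage.

Lemma line_sub_eq (F : fieldType) (T : vectType F) (A B : {vspace T}) :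
  line A -> line B -> (A <= B)%VS -> A = B.
Proof. by move=> lA lB sAB; apply/eqP; rewrite eqEdim sAB lA lB. Qed.

Lemma pointP (F : fieldType) (T : vectType F) (p : {vspace T}) :
  point p -> exists2 x, x != 0 & p = <[x]>%VS.
Proof.
move=> p1; exists (vpick p); first by rewrite vpick0 -dimv_eq0 p1.
apply/esym/eqP; rewrite eqEdim dim_vline vpick0 -dimv_eq0 p1 andbT.
by rewrite -memvE memv_pick.
Qed.

Lemma pointE (F : fieldType) (T : vectType F) (x : T) :
  x != 0 -> point <[x]>%VS.
Proof. by rewrite /point dim_vline => ->. Qed.

Lemma line_add (F : fieldType) (T : vectType F) (x y : T) :
  x != 0 -> y \notin <[x]>%VS -> line (<[x]> + <[y]>)%VS.
Proof.
move=> x0 yx; have y0 : y != 0 by apply: contraNneq yx => ->; apply: mem0v.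
rewrite /line dimv_disjoint_sum ?dim_vline ?x0 ?y0 //.
apply/eqP; rewrite -subv0; apply/subvP => z.
rewrite memv_cap => /andP[zx] /vlineP[c zE]; move: zx; rewrite zE.
have [-> | c0] := eqVneq c 0; first by rewrite scale0r => _; apply: mem0v.
by rewrite rpredZeq (negPf c0) (negPf yx).
Qed.

Lemma addvv_char2 (R : pzRingType) (V : lmodType R) (v : V) :
  1 + 1 = 0 :> R -> v + v = 0.
Proof. by move=> two0; rewrite -{1 2}[v]scale1r -scalerDl two0 scale0r. Qed.

Section BinaryField.
Variable T : vectType 'F_2.
Implicit Types x y : T.

Lemma F2P (c : 'F_2) : c = 0 \/ c = 1.
Proof. case: c => [[|[|n]] i]; by [left; apply: val_inj | right; apply: val_inj | ]. Qed.

Lemma addvv x : x + x = 0.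
Proof. by apply: addvv_char2; apply: val_inj. Qed.

Lemma oppv x : - x = x.
Proof. by apply/eqP; rewrite eq_sym -addr_eq0 addvv. Qed.

(** Over F_2 a point is the same thing as a nonzero vector; the arguments on
    the binary Segre variety rest on this. *)
Lemma mem_vline2 x y : x \in <[y]>%VS -> x = 0 \/ x = y.
Proof.
by case/vlineP=> c ->; have [->|->] := F2P c; rewrite ?scale0r ?scale1r; auto.
Qed.

Lemma vline2_inj x y : x != 0 -> <[x]>%VS = <[y]>%VS -> x = y.
Proof.
move=> x0 xy; have := memv_line x; rewrite xy => /mem_vline2[] // xE.
by rewrite xE eqxx in x0.
Qed.

Variable s : 'End(T).
Hypothesis s_quad : forall t, s (s t) = s t + t.

(** The polynomial x^2 + x + 1 has no root in F_2, so [s] has no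
    eigenvector. *)
Lemma quad_notin_line t : t != 0 -> s t \notin <[t]>%VS.
Proof.
move=> t0; apply/negP=> /mem_vline2[] st; have := s_quad t.
  by rewrite st linear0 add0r => t00; rewrite -t00 eqxx in t0.
by rewrite !st addvv => t00; rewrite t00 eqxx in t0.
Qed.

Lemma quad_neq0 t : t != 0 -> s t != 0.
Proof. by move/quad_notin_line; apply: contraNneq => ->; apply: mem0v. Qed.

Definition quad_line t : {vspace T} := (<[t]> + <[s t]>)%VS.

Definition quad_spread (l : {vspace T}) : Prop :=
  exists2 t, t != 0 & l = quad_line t.

Lemma quad_lineP t : t != 0 -> line (quad_line t).
Proof. by move=> t0; apply: line_add (quad_notin_line t0). Qed.

Lemma mem_quad_line t : t \in quad_line t.
Proof. by rewrite (subvP (addvSl _ _)) ?memv_line. Qed.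

Lemma quad_line_stable t u : u \in quad_line t -> s u \in quad_line t.
Proof.
case/memv_addP=> _ /vlineP[c ->] [_ /vlineP[d ->] ->].
rewrite linearD !linearZ /= s_quad; apply: rpredD; apply: rpredZ.
  by rewrite (subvP (addvSr _ _)) ?memv_line.
by rewrite rpredD ?mem_quad_line // (subvP (addvSr _ _)) ?memv_line.
Qed.

Lemma quad_line_sub (A : {vspace T}) t :
  (forall u, u \in A -> s u \in A) -> t \in A -> (quad_line t <= A)%VS.
Proof. by move=> sA tA; rewrite subv_add -!memvE tA sA. Qed.

Lemma quad_line_eq t u : t != 0 -> u != 0 -> u \in quad_line t ->
  quad_line u = quad_line t.
Proof.
move=> t0 u0 ut; apply: line_sub_eq; try exact: quad_lineP.
by apply: quad_line_sub ut => ?; apply: quad_line_stable.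
Qed.

(** An [s]-stable subspace is an F_4-subspace, and the spread lines are the
    F_4-lines: two of them that share a nonzero vector coincide. *)
Lemma quad_spread_stable (A : {vspace T}) : (forall u, u \in A -> s u \in A) ->
  line_spread A (fun l => quad_spread l /\ (l <= A)%VS).
Proof.
move=> sA; split=> [l [[t t0 ->] tA] | p /pointP[t t0 ->]].
  by split=> //; apply: quad_lineP.
rewrite -memvE => tA; exists (quad_line t); split.
  by rewrite -memvE mem_quad_line; split=> //; split; [exists t | apply: quad_line_sub].
move=> _ [[[u u0 ->] _]]; rewrite -memvE => /quad_line_eq; exact.
Qed.

Lemma quad_spread_geometric : geometric_line_spread quad_spread.
Proof.
split=> [|l1 l2 [t t0 ->] [u u0 ->] _].
  have [lA spA] := quad_spread_stable (fun u _ => memvf (s u)).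
  split=> [l Ll | p pp pA]; first by apply: lA; split=> //; apply: subvf.
  have [l [[[Ll _] pl] lU]] := spA p pp pA; exists l; split=> // l' [Ll' pl'].
  by apply: lU; do 2!split=> //; apply: subvf.
apply: quad_spread_stable => _ /memv_addP[v tv [w uw ->]].
by rewrite linearD memv_add ?quad_line_stable.
Qed.

End BinaryField.

(** * Multilinear maps and tensor products *)

Section Families.
Variables (m : nat) (T : 'I_m -> Type).
Implicit Types a b : forall k, T k.

(** Passing from [a] to [b] one entry at a time: [n] counts the entries
    already replaced. *)
Definition splice n a b : forall k, T k :=
  fun k => if (k < n)%N then b k else a k.

Lemma splice0 a b : splice 0 a b = a.
Proof. exact: functional_extensionality_dep. Qed.

Lemma splice_all a b : splice m a b = b.
Proof. by apply: functional_extensionality_dep => k; rewrite /splice ltn_ord. Qed.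

Lemma spliceS (j : 'I_m) a b : splice j.+1 a b = dfwith (splice j a b) (b j).
Proof.
apply: functional_extensionality_dep => k; rewrite /splice.
case: dfwithP => [|i ji]; first by rewrite ltnSn.
by rewrite ltnS leq_eqVlt eq_sym (inj_eq val_inj) (negPf ji).
Qed.

Lemma dfwith_id a k : dfwith a (a k) = a.
Proof. by apply: functional_extensionality_dep => i; case: dfwithP. Qed.

Lemma dfwithK a k (x y : T k) : dfwith (dfwith a x) y = dfwith a y.
Proof.
apply: functional_extensionality_dep => i.
by case: (dfwithP _ y) => [|j kj]; rewrite ?dfwith_in ?dfwith_out.
Qed.

Lemma dfwithC a j k (x : T j) (y : T k) : j != k ->
  dfwith (dfwith a x) y = dfwith (dfwith a y) x.
Proof.
move=> jk; apply: functional_extensionality_dep => i.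
have [<-|ji] := eqVneq j i; first by rewrite dfwith_in dfwith_out 1?eq_sym ?dfwith_in.
have [<-|ki] := eqVneq k i; first by rewrite dfwith_in dfwith_out ?dfwith_in.
by rewrite !dfwith_out.
Qed.

(** Any two admissible families are joined by a chain of admissible families
    in which consecutive ones differ in a single entry.  For nonzero vectors
    this is the connectedness of the Segre variety through its generators. *)
Lemma family_connected (Q : forall k, T k -> Prop)
    (P : (forall k, T k) -> Prop) :
  (forall a k x, (forall j, Q j (a j)) -> Q k x -> P a -> P (dfwith a x)) ->
  forall a b, (forall k, Q k (a k)) -> (forall k, Q k (b k)) -> P a -> P b.
Proof.
move=> stepP a b Qa Qb Pa; rewrite -(splice_all a b).
elim: {-2}m (leqnn m) => [|n IHn] lt_nm; first by rewrite splice0.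
rewrite (spliceS (Ordinal lt_nm)); apply: stepP => //.
  by move=> j; rewrite /splice; case: ifP.
by apply: IHn; apply: ltnW.
Qed.

End Families.

Section Multilinear.
Variables (F : fieldType) (m : nat) (V : 'I_m -> vectType F).

Lemma multilinearD (U : vectType F) (f : (forall k, V k) -> U) a k x y :
  multilinear f -> f (dfwith a (x + y : V k)) = f (dfwith a x) + f (dfwith a y).
Proof. by move=> fL; have := fL a k 1 x y; rewrite !scale1r. Qed.

Lemma multilinear0 (U : vectType F) (f : (forall k, V k) -> U) a k :
  multilinear f -> f (dfwith a (0 : V k)) = 0.
Proof.
move=> fL; have := multilinearD a (0 : V k) 0 fL.
by rewrite addr0 => /eqP; rewrite -subr_eq0 opprD addrA subrr sub0r oppr_eq0 => /eqP.
Qed.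

Lemma multilinearZ (U : vectType F) (f : (forall k, V k) -> U) a k c x :
  multilinear f -> f (dfwith a (c *: x : V k)) = c *: f (dfwith a x).
Proof.
by move=> fL; have := fL a k c x 0; rewrite !addr0 => ->; rewrite multilinear0 ?addr0.
Qed.

Lemma multilinear_comp (U U' : vectType F) (f : (forall k, V k) -> U)
    (g : 'Hom(U, U')) : multilinear f -> multilinear (fun a => g (f a)).
Proof. by move=> fL a k c x y /=; rewrite fL linearP. Qed.

(** The entries of [a] are replaced one by one by basis vectors, which avoids
    the expansion of a product of sums. *)
Lemma multilinear_ext (B : forall k, bool -> V k) (U : vectType F)
    (f g : (forall k, V k) -> U) :
  (forall k v, exists c0 c1, v = c0 *: B k false + c1 *: B k true) ->
  multilinear f -> multilinear g ->
  (forall i : {ffun 'I_m -> bool},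
     f (fun k => B k (i k)) = g (fun k => B k (i k))) ->
  forall a, f a = g a.
Proof.
move=> spanB fL gL eq_fg a.
pose Bf (i : 'I_m -> bool) := (fun k => B k (i k)) : forall k, V k.
suff eq_splice n : (n <= m)%N ->
    forall i, f (splice n (Bf i) a) = g (splice n (Bf i) a).
  by have := eq_splice m (leqnn m) xpred0; rewrite splice_all.
elim: n => [|n IHn] lt_nm i.
  rewrite splice0; have := eq_fg (finfun i).
  by have -> // : (fun k => B k (finfun i k)) = Bf i;
     apply: functional_extensionality_dep => k; rewrite ffunE.
have eq_dfwith b : f (dfwith (splice n (Bf i) a) (B (Ordinal lt_nm) b)) =
                   g (dfwith (splice n (Bf i) a) (B (Ordinal lt_nm) b)).
  pose i' (k : 'I_m) := if k == Ordinal lt_nm then b else i k.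
  have -> : dfwith (splice n (Bf i) a) (B (Ordinal lt_nm) b) =
            splice n (Bf i') a.
    apply: functional_extensionality_dep => k; rewrite /splice /Bf /i'.
    case: dfwithP => [|j]; first by rewrite /= ltnn eqxx.
    by rewrite eq_sym => /negPf ->.
  exact: IHn (ltnW lt_nm) i'.
rewrite (spliceS (Ordinal lt_nm)).
have [c0 [c1 ->]] := spanB _ (a (Ordinal lt_nm)).
by rewrite !multilinearD // !multilinearZ // !eq_dfwith.
Qed.

Lemma multilinear_prod (f : forall k, 'Hom(V k, F^o)) :
  multilinear (fun a => \prod_k f k (a k) : F^o).
Proof.
have prodE a k (x : V k) : \prod_i f i (dfwith a x i) =
    f k x * \prod_(i | i != k) f i (a i).
  rewrite (bigD1 k) //= dfwith_in; congr (_ * _).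
  by apply: eq_bigr => i ik; rewrite dfwith_out // eq_sym.
move=> a k c x y; rewrite !prodE linearP.
by rewrite -![_ *: _]/(_ * _) mulrDl mulrA.
Qed.

(** This is the multilinear map behind the Leibniz rule: endomorphisms of the
    factors act on the tensor product as a sum of one-factor actions. *)
Lemma multilinear_leibniz (U : vectType F) (f : (forall k, V k) -> U)
    (h : forall k, 'End(V k)) : multilinear f ->
  multilinear (fun a => \sum_k f (dfwith a (h k (a k)))).
Proof.
move=> fL a j c x y; rewrite scaler_sumr -big_split /=; apply: eq_bigr => k _.
have [<-|jk] := eqVneq j k.
  by rewrite !dfwithK !dfwith_in linearP multilinearD // multilinearZ.
by rewrite !(dfwith_out _ _ jk) !(dfwithC _ _ _ jk) // multilinearD // multilinearZ.
Qed.

Variables (T : vectType F) (tens : (forall k, V k) -> T).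
Hypothesis tensP : is_tensor_product tens.

Lemma tensor_hom_ext (U : vectType F) (g h : 'Hom(T, U)) :
  (forall a, g (tens a) = h (tens a)) -> g = h.
Proof.
move=> eq_gh; have [tensL univ] := tensP.
have [r [_ r_uniq]] := univ U (fun a => h (tens a)) (multilinear_comp h tensL).
by rewrite -(r_uniq g) // -(r_uniq h).
Qed.

Lemma tensor_hom (U : vectType F) (f : (forall k, V k) -> U) :
  multilinear f -> exists g : 'Hom(T, U), forall a, g (tens a) = f a.
Proof. by case: tensP => _ univ /univ[g [gE _]]; exists g. Qed.

Lemma tensor_form (f : forall k, 'Hom(V k, F^o)) :
  exists phi : 'Hom(T, F^o), forall a, phi (tens a) = \prod_k f k (a k).
Proof. exact: tensor_hom (multilinear_prod f). Qed.

Lemma tensor_derivation (h : forall k, 'End(V k)) :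
  exists s : 'End(T), forall a, s (tens a) = \sum_k tens (dfwith a (h k (a k))).
Proof. by apply/tensor_hom/multilinear_leibniz; case: tensP. Qed.

(** The projection onto [X] and the identity agree on tensors of basis
    vectors, hence are equal. *)
Lemma tensor_span (B : forall k, bool -> V k) (X : {vspace T}) :
  (forall k v, exists c0 c1, v = c0 *: B k false + c1 *: B k true) ->
  (forall i : {ffun 'I_m -> bool}, tens (fun k => B k (i k)) \in X) ->
  X = fullv.
Proof.
move=> spanB BX; have [tensL _] := tensP.
have projX : projv X = \1%VF.
  apply: tensor_hom_ext => a.
  apply: (multilinear_ext spanB (multilinear_comp _ tensL)
                          (multilinear_comp _ tensL)) => i.
  by rewrite id_lfunE projv_id.
apply/eqP; rewrite eqEsubv subvf; apply/subvP => t _.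
by rewrite -[t]id_lfunE -projX memv_proj.
Qed.

(** A product of forms [f k] with [f k (a k) = 1] and [f k (y k) = 0] takes
    the value 1 at [tens a] and vanishes at every pure tensor that shares a
    factor with [y].  By the choice of [y] one such form serves all the
    comparisons of pure tensors below. *)
Lemma tensor_separating_form (a y : forall k, V k) :
  (forall k, a k \notin <[y k]>%VS) ->
  exists2 phi : 'Hom(T, F^o), phi (tens a) = 1
    & forall x k, x k = y k -> phi (tens x) = 0.
Proof.
move=> ay; have [f fP] := fin_all_exists (fun k => separating_functional (ay k)).
have [phi phiE] := tensor_form f; exists phi.
  by rewrite phiE big1 // => k _; case: (fP k).
move=> x k xk; rewrite phiE (bigD1 k) //= xk.
by have [_ ->] := fP k; rewrite ?mul0r ?memv_line.
Qed.

Lemma tensor_neq0 a : (forall k, a k != 0) -> tens a != 0.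
Proof.
move=> a0; have [|phi phi1 _] := @tensor_separating_form a (fun k => 0).
  by move=> k; apply: contra (a0 k) => /vlineP[c ->]; rewrite scaler0.
by apply/eqP=> ta0; move/eqP: phi1; rewrite ta0 linear0 eq_sym oner_eq0.
Qed.

Lemma tensor_dual_basis (e0 e1 : forall k, V k) :
  (forall k, basis_of {:V k} [:: e0 k; e1 k]) ->
  let E (i : {ffun 'I_m -> bool}) := tens (fun k => if i k then e1 k else e0 k) in
  exists phi : {ffun 'I_m -> bool} -> 'Hom(T, F^o),
    (forall i j, phi i (E j) = (i == j)%:R) /\
    (forall t, t = \sum_i phi i t *: E i).
Proof.
move=> eB E.
have /fin_all_exists[f f_dual] : forall k, exists fk : bool -> 'Hom(V k, F^o),
    forall b b', fk b (if b' then e1 k else e0 k) = (b == b')%:R.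
  move=> k.
  have [f0 [f00 f01]] := hom_of_basis (1 : F^o) 0 (eB k).
  have [f1 [f10 f11]] := hom_of_basis (0 : F^o) 1 (eB k).
  by exists (fun b => if b then f1 else f0) => -[] [].
have [phi phiE] := fin_all_exists
  (fun i : {ffun 'I_m -> bool} => tensor_form (fun k => f k (i k))).
have phi_dual i j : phi i (E j) = (i == j)%:R.
  rewrite phiE; have [<-|ij] := eqVneq i j.
    by rewrite big1 // => k _; rewrite f_dual eqxx.
  have [k ijk] : exists k, i k != j k.
    apply/existsP; apply: contraNT ij => /existsPn ij.
    by apply/eqP/ffunP => k; apply/eqP/negbNE/ij.
  by rewrite (bigD1 k) //= f_dual (negPf ijk) mul0r.
exists phi; split=> // t.
have: t \in fullv by apply: memvf.
suff <- : (\sum_i <[E i]>)%VS = fullv :> {vspace T}.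
  case/memv_sumP=> c Ec ->; have {}Ec i : exists d, c i = d *: E i.
    exact/vlineP/Ec.
  have [d dE] := fin_all_exists Ec; rewrite (eq_bigr _ (fun i _ => dE i)).
  apply: eq_bigr => i _; congr (_ *: _); rewrite linear_sum (bigD1 i) //=.
  rewrite linearZ /= phi_dual eqxx [_ *: _]mulr1 big1 ?addr0 // => j ji.
  by rewrite linearZ /= phi_dual eq_sym (negPf ji) scaler0.
apply: (@tensor_span (fun k b => if b then e1 k else e0 k)) => [k v | i].
  exact: basis2_expand.
by rewrite memvE (sumv_sup i).
Qed.

End Multilinear.

(** * The binary Segre variety *)

Section BinarySegre.
Variables (m : nat) (V : 'I_m -> vectType 'F_2).
Variables (T : vectType 'F_2) (tens : (forall k, V k) -> T).
Hypotheses (dimV : forall k, \dim {:V k} = 2%N) (tensP : is_tensor_product tens).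
Implicit Types a b c : forall k, V k.

Let tensL : multilinear tens := proj1 tensP.

Lemma pure_separating_form a y :
  (forall k, a k != 0) -> (forall k, a k <> y k) ->
  exists2 phi : 'Hom(T, ('F_2)^o), phi (tens a) = 1
    & forall x k, x k = y k -> phi (tens x) = 0.
Proof.
move=> a0 ay; apply: tensor_separating_form => // k; apply/negP.
by case/mem_vline2=> [ak0 | /ay//]; have := a0 k; rewrite ak0 eqxx.
Qed.

Lemma pure_inj a b : (forall k, a k != 0) -> tens a = tens b -> a = b.
Proof.
move=> a0 tab; apply: functional_extensionality_dep => j.
apply/eqP/negPn/negP => /eqP abj.
have [|phi phi1 phi0] := @pure_separating_form a (dfwith (fun k => 0 : V k) (b j)) a0.
  by move=> k; case: dfwithP => // i _; apply/eqP.
by move/eqP: phi1; rewrite tab (phi0 _ j) ?dfwith_in.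
Qed.

(** A product form that is 1 at [a] and vanishes on [b] through the [j]-th
    factor and on [c] through the [i]-th one would give 1 + 0 = 0. *)
Lemma pure_sum_left a b c j i :
  (forall k, a k != 0) -> tens a + tens b = tens c ->
  a j <> b j -> i != j -> a i = c i.
Proof.
move=> a0 tabc abj ij; apply/eqP/negPn/negP => /eqP aci.
have [|phi phi1 phi0] :=
    @pure_separating_form a (dfwith (dfwith (fun k => 0 : V k) (b j)) (c i)) a0.
  by move=> k; case: dfwithP => // ? _; case: dfwithP => // ? _; apply/eqP.
have := congr1 phi tabc; rewrite linearD /= phi1 (phi0 c i) ?dfwith_in //.
rewrite (phi0 b j); last by rewrite dfwith_out // dfwith_in.
by rewrite addr0 => /eqP; rewrite oner_eq0.
Qed.

(** The lines contained in the Segre variety are its generators: if [b]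
    differs from [a] in the [j]-th entry, both agree with [c] in all the
    others. *)
Lemma pure_sum a b c j :
  (forall k, a k != 0) -> (forall k, b k != 0) -> tens a + tens b = tens c ->
  a j <> b j -> b = dfwith a (b j).
Proof.
move=> a0 b0 tabc abj; apply: functional_extensionality_dep => i.
case: dfwithP => // {}i ji; rewrite eq_sym in ji.
rewrite (pure_sum_left a0 tabc abj ji).
by apply: (pure_sum_left b0 _ (nesym abj) ji); rewrite addrC.
Qed.

Variable sigma : forall k, 'End(V k).
Hypothesis sigma_quad : forall k v, sigma k (sigma k v) = sigma k v + v.

(** A second point of the [k]-th generator through [tens a]. *)
Let nbr a k := tens (dfwith a (sigma k (a k))).

Variable s : 'End(T).
Hypothesis sE : forall a, s (tens a) = \sum_k nbr a k.

(** On a plane, [sigma k] turns every nonzero vector into a basis. *)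
Lemma quad_span k (v : V k) : v != 0 -> quad_line (sigma k) v = fullv.
Proof.
move=> v0; apply: line_sub_eq; [exact: quad_lineP | exact: dimV | exact: subvf].
Qed.

(** Adding [tens a] to a neighbour gives the remaining point of the same
    generator. *)
Lemma nbr_addE a k (e : 'F_2) :
  nbr a k + e *: tens a = tens (dfwith a (sigma k (a k) + e *: a k)).
Proof. by rewrite multilinearD // multilinearZ // dfwith_id. Qed.

Lemma pure_neighbour a b c :
  (forall k, a k != 0) -> (forall k, b k != 0) -> (forall k, c k != 0) ->
  tens a + tens b = tens c ->
  exists k e, tens b = nbr a k + e *: tens a.
Proof.
move=> a0 b0 c0 tabc.
have [j abj] : exists j, a j != b j.
  apply/existsP; apply: contraNT (tensor_neq0 tensP c0) => /existsPn ab.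
  rewrite -tabc; suff -> : a = b by rewrite addvv.
  by apply: functional_extensionality_dep => j; apply/eqP/negbNE/ab.
have bE := pure_sum a0 b0 tabc (elimN eqP abj).
have := memvf (b j); rewrite -(quad_span (a0 j)).
case/memv_addP=> _ /vlineP[e ->] [_ /vlineP[d ->] bj].
exists j, e; rewrite nbr_addE bE bj addrC.
have [d0|->] := F2P d; last by rewrite scale1r.
move: bj abj (b0 j); rewrite d0 scale0r addr0 => ->.
by have [->|->] := F2P e; rewrite ?scale0r ?scale1r eqxx.
Qed.

Lemma nbr_arg_neq0 k (v : V k) (e : 'F_2) : v != 0 -> sigma k v + e *: v != 0.
Proof.
move=> v0; apply: contraNneq (quad_notin_line (sigma_quad (k := k)) v0).
by rewrite -[e *: v]oppv => /subr0_eq ->; rewrite memvZ ?memv_line.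
Qed.

Lemma dfwith_neq0 a k x :
  (forall j, a j != 0) -> x != 0 -> forall j, dfwith a (x : V k) j != 0.
Proof. by move=> a0 x0 j; case: dfwithP. Qed.

(** Neighbours on different generators are distinct, even modulo
    [tens a]. *)
Lemma nbr_neq a k k' (e : 'F_2) : (forall j, a j != 0) ->
  nbr a k = nbr a k' + e *: tens a -> k = k'.
Proof.
move=> a0; rewrite nbr_addE => /pure_inj eq_nbr.
apply/eqP/negPn/negP => kk'.
have := congr1 (fun f => f k) (eq_nbr _); rewrite dfwith_in dfwith_out 1?eq_sym //.
move=> sak; have := nbr_arg_neq0 1 (a0 k); rewrite scale1r sak ?addvv ?eqxx //.
by apply: dfwith_neq0 => //; apply: quad_neq0 (a0 k) => ?; apply: sigma_quad.
Qed.

Section Collineation.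
Variable g : 'End(T).
Hypotheses (g_inj : lker g = 0%VS).
Hypothesis g_pure : forall a, (forall k, a k != 0) ->
  exists2 b : forall k, V k, forall k, b k != 0 & g (tens a) = tens b.

Let ginj : injective g. Proof. by apply/lker0P; rewrite g_inj. Qed.

(** The generators on [tens a] go to the generators on its image, so [g]
    carries the sum of the neighbours of [a] to the sum of the neighbours of
    the image, up to a multiple of the image. *)
Lemma collineation_eigen a : (forall k, a k != 0) ->
  exists c : 'F_2, g (s (tens a)) = s (g (tens a)) + c *: g (tens a).
Proof.
move=> a0; have [b b0 gab] := g_pure a0.
have nbr0 k := dfwith_neq0 a0 (nbr_arg_neq0 _ (a0 k)).
have /fin_all_exists[tau tauP] : forall k, exists j, exists e,
    g (nbr a k) = nbr b j + e *: tens b.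
  (* The line joining the tensor to its neighbour consists of pure tensors,
     and so does its image. *)
  move=> k; have [b' b'0 gb'] := g_pure (nbr0 0 k).
  have [c c0 gc] := g_pure (nbr0 1 k).
  move: gb' gc; rewrite -!nbr_addE scale0r addr0 scale1r linearD /= gab => -> gc.
  by apply: pure_neighbour c0 _ => //; rewrite addrC.
have [e eP] := fin_all_exists tauP.
have tau_inj : injective tau.
  move=> k k' kk'; apply: (@nbr_neq a k k' (e k - e k')) => //; apply: ginj.
  rewrite linearD linearZ /= gab (eP k) (eP k') -kk' scalerBl -addrA.
  by rewrite [X in _ = _ + X]addrC subrK.
exists (\sum_k e k); rewrite gab !sE linear_sum (eq_bigr _ (fun k _ => eP k)) /=.
by rewrite big_split /= -scaler_suml [in RHS](reindex_inj tau_inj).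
Qed.

(** The scalar of [collineation_eigen] is the same at all pure tensors: if it
    took different values at two vectors p and q of a generator, comparison
    with the value at the third vector p + q would make the image of p or of q
    vanish. *)
Lemma collineation_commute :
  exists c : 'F_2, forall t, g (s t) = s (g t) + c *: g t.
Proof.
have [a a0] : exists a, forall k, a k != 0.
  exists (fun k => vpick {:V k}) => k.
  by rewrite vpick0 -dimv_eq0 dimV.
have [c ca] := collineation_eigen a0; exists c.
have gtens0 b : (forall k, b k != 0) -> g (tens b) != 0.
  by move=> /(tensor_neq0 tensP); apply: contra_neq => gb; apply: ginj; rewrite gb linear0.
have c_pure b : (forall k, b k != 0) ->
    g (s (tens b)) = s (g (tens b)) + c *: g (tens b).
  move=> b0; apply: (family_connected (Q := fun k x => x != 0) (P := fun b =>
    g (s (tens b)) = s (g (tens b)) + c *: g (tens b)) _ a0 b0 ca).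
  move=> {a0 b0 ca b}a k x a0 x0 ca.
  have [->|xa] := eqVneq x (a k); first by rewrite dfwith_id.
  have ax0 : a k + x != 0 by rewrite addr_eq0 oppv eq_sym.
  have [c1 c1E] := collineation_eigen (dfwith_neq0 a0 x0).
  have [c2] := collineation_eigen (dfwith_neq0 a0 ax0).
  rewrite multilinearD // dfwith_id !linearD /= ca c1E => c2E.
  have p0 := gtens0 _ a0; have q0 := gtens0 _ (dfwith_neq0 a0 x0).
  move: p0 q0 c2E {ca} c1E; set p := g (tens a); set q := g (tens _) => p0 q0.
  rewrite addrACA => /addrI.
  case: (F2P c) (F2P c1) (F2P c2) => [->|->] [->|->] [->|->];
    rewrite ?scale0r ?scale1r ?add0r ?addr0 // => /eqP.
  - by rewrite (negPf q0).
  - by rewrite -{1}[q]add0r (inj_eq (addIr _)) eq_sym (negPf p0).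
  - by rewrite (negPf p0).
  - by rewrite -{1}[p]addr0 (inj_eq (addrI _)) eq_sym (negPf q0).
suff comm : (g \o s)%VF = (s \o g + c *: g)%VF.
  by move=> t; rewrite -comp_lfunE comm add_lfunE comp_lfunE scale_lfunE.
apply: (tensor_hom_ext tensP) => b; rewrite add_lfunE scale_lfunE !comp_lfunE.
have [/forallP b0 | /forallPn[k]] := boolP [forall k, b k != 0].
  exact: c_pure.
rewrite negbK => /eqP bk0; have -> : tens b = 0.
  by rewrite -(dfwith_id b k) bk0 multilinear0.
by rewrite !(linear0, scaler0) addr0.
Qed.

(** In terms of the F_4-structure, [g] is linear when the scalar is 0 and
    semilinear for the Frobenius map when it is 1; both preserve F_4-lines. *)
Lemma collineation_quad_line :
  forall t, (g @: quad_line s t)%VS = quad_line s (g t).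
Proof.
move=> t; have [c gs] := collineation_commute.
rewrite /quad_line limgD !limg_line gs; have [->|->] := F2P c.
  by rewrite scale0r addr0.
rewrite scale1r; apply/eqP; rewrite eqEsubv !subv_add -!memvE.
have gt (x : T) : g t \in (<[g t]> + <[x]>)%VS.
  by rewrite (subvP (addvSl _ _)) ?memv_line.
have xx (x : T) : x \in (<[g t]> + <[x]>)%VS.
  by rewrite (subvP (addvSr _ _)) ?memv_line.
rewrite !gt !andTb; apply/andP; split; first by rewrite rpredD ?gt ?xx.
by rewrite -{1}[s (g t)](addrK (g t)) rpredB ?gt ?xx.
Qed.

Lemma collineation_quad_spread l :
  quad_spread s l <-> quad_spread s (g @: l)%VS.
Proof.
have g0 t : (g t != 0) = (t != 0) by rewrite -[in RHS](inj_eq ginj) linear0.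
split=> [[t t0 ->] | [t t0 gl]].
  by exists (g t); rewrite ?g0 // collineation_quad_line.
have gK := lker0_lfunVK (introT eqP g_inj).
exists ((g^-1)%VF t); first by rewrite -g0 gK.
apply/eqP; rewrite -(eq_limg_ker0 _ _ (introT eqP g_inj)).
by rewrite gl collineation_quad_line gK.
Qed.

End Collineation.

Lemma segre_group_quad_spread phi l :
  segre_group tens phi -> quad_spread s l <-> quad_spread s (phi l).
Proof.
move=> [[g g_inj phiE] phi_segre]; rewrite phiE.
apply: collineation_quad_spread => // a a0.
have : segre tens (phi <[tens a]>%VS) by apply/phi_segre; exists <[tens a]>%VS; [exists a|].
case=> b b0; rewrite phiE limg_line => gab; exists b => //.
apply: vline2_inj gab; apply: contraNneq (tensor_neq0 tensP a0) => ga0.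
by apply/eqP; apply: (elimT lker0P (introT eqP g_inj)); rewrite ga0 linear0.
Qed.

(** The generator joins [tens a] to its [k]-th neighbour. *)
Lemma segre_generatorE a k : a k != 0 ->
  segre_generator tens a k = (<[tens a]> + <[nbr a k]>)%VS.
Proof.
move=> ak0; apply/eqP; rewrite eqEsubv; apply/andP; split.
  apply/span_subvP => _ /mapP[x _ ->]; have := memvf x; rewrite -(quad_span ak0).
  case/memv_addP=> _ /vlineP[c ->] [_ /vlineP[d ->] ->].
  by rewrite multilinearD // !multilinearZ // dfwith_id memv_add ?memvZ ?memv_line.
have gen x : tens (dfwith a (x : V k)) \in segre_generator tens a k.
  apply: (mem_semilinear_image (theta := id) (f := fun x : V k => tens (dfwith a x))).
  - exact: tensL.
  - exact: multilinear0.
  - exact: memvf.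
by rewrite subv_add -!memvE gen -{1}(dfwith_id a k) gen.
Qed.

Hypothesis s_quad : forall t, s (s t) = s t + t.

(** Modulo [tens a], a second vector of the tangent is a combination of the
    neighbours.  No coefficient vanishes, as otherwise the tangent would lie in
    the span of the other generators; over F_2 they are all 1, and the sum of
    the neighbours is [s (tens a)]. *)
Lemma distinguished_tangentE a l : (forall k, a k != 0) ->
  distinguished_tangent_at tens a l -> l = quad_line s (tens a).
Proof.
move=> a0 [[l2 al tan_l] not_sub]; set p := tens a in al *.
have p0 : p != 0 := tensor_neq0 tensP a0.
have [y ly yp] : exists2 y, y \in l & y \notin <[p]>%VS.
  apply/subvPn; apply/negP=> /dimvS; by rewrite l2 dim_vline p0.
have lE : l = (<[p]> + <[y]>)%VS.
  apply/esym/line_sub_eq => //; first exact: line_add.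
  by rewrite subv_add al -memvE.
suff [d yE] : exists d : 'F_2, y = d *: p + s p.
  apply: line_sub_eq => //; first exact: quad_lineP.
  rewrite lE subv_add -!memvE mem_quad_line yE rpredD ?rpredZ ?mem_quad_line //.
  exact/quad_line_stable/mem_quad_line.
have := subvP tan_l y ly; case/memv_sumP=> v vP yE.
have {}vP k : exists c : 'F_2 * 'F_2, v k = c.1 *: p + c.2 *: nbr a k.
  have := vP k isT; rewrite segre_generatorE //.
  case/memv_addP=> _ /vlineP[c ->] [_ /vlineP[d ->] ->].
  by exists (c, d).
have [c vE] := fin_all_exists vP.
suff c1 k : (c k).2 = 1.
  exists (\sum_k (c k).1); rewrite yE sE scaler_suml -big_split /=.
  by apply: eq_bigr => k _; rewrite vE c1 scale1r.
have [ck0|//] := F2P (c k).2.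
case/negP: (not_sub k); have vk : v k \in <[p]>%VS.
  by rewrite vE ck0 scale0r addr0 memvZ ?memv_line.
have y_sum : y = v k + \sum_(i | i != k) v i by rewrite yE (bigD1 k).
have sum_gen : \sum_(i | i != k) v i \in
    (\sum_(i < m | i != k) segre_generator tens a i)%VS.
  by apply: memv_sumr => i _; rewrite vE segre_generatorE // memv_add ?memvZ ?memv_line.
(* When m = 1 there is no other generator, and y would be a multiple of p. *)
have [j jk] : exists j, j != k.
  apply/existsP; apply: contraNT yp => /existsPn no_j.
  by rewrite y_sum big1 ?addr0 // => i ik; have := no_j i; rewrite ik.
have p_gen : (<[p]> <= \sum_(i < m | i != k) segre_generator tens a i)%VS.
  by apply: (sumv_sup j jk); rewrite segre_generatorE // addvSl.
by rewrite lE subv_add p_gen -memvE y_sum rpredD // (subvP p_gen).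
Qed.

End BinarySegre.

(** * Extension of scalars *)

Section ScalarExtension.
Variables (K : fieldType) (L : fieldExtType K) (V : vectType K) (W : vectType L).
Variable iota : V -> W.
Hypothesis iotaP : is_scalar_extension iota.

Lemma scalar_extension_hom_ext (U : vectType L) (g h : 'Hom(W, U)) :
  (forall v, g (iota v) = h (iota v)) -> g = h.
Proof.
move=> eq_gh; have [iotaL univ] := iotaP.
have [|r [_ r_uniq]] := univ U (fun v => h (iota v)).
  by move=> c u v; rewrite iotaL linearP.
by rewrite -(r_uniq g) // -(r_uniq h).
Qed.

(** The coordinate forms on [V] extend to [W], which gives freeness; the
    projection onto the span agrees with the identity on the image of [iota],
    which gives generation. *)
Lemma scalar_extension_basis (e0 e1 : V) :
  basis_of {:V} [:: e0; e1] -> basis_of {:W} [:: iota e0; iota e1].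
Proof.
move=> eB; have [iotaL univ] := iotaP.
have iota_form (f : 'Hom(V, K^o)) :
    exists F : 'Hom(W, L^o), forall v, F (iota v) = (f v)%:A.
  have [|F [FE _]] := univ L^o (fun v => (f v)%:A); last by exists F.
  move=> c u v; rewrite linearP /= scalerDl; congr (_ + _).
  by rewrite -[RHS]/(_ * _) mulr_algl scalerA.
have [h0 [h00 h01]] := hom_of_basis (1 : K^o) 0 eB.
have [h1 [h10 h11]] := hom_of_basis (0 : K^o) 1 eB.
have [F0 F0E] := iota_form h0; have [F1 F1E] := iota_form h1.
apply/andP; split.
  apply/eqP; have projX : projv <<[:: iota e0; iota e1]>> = \1%VF.
    apply: scalar_extension_hom_ext => v; rewrite id_lfunE projv_id //.
    have [c0 [c1 ->]] := basis2_expand v eB.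
    have iota0 : iota 0 = 0.
      by have := iotaL (-1) 0 0; rewrite scaler0 addr0 /= scaleN1r scaleN1r addNr.
    rewrite -[c1 *: e1]addr0 !iotaL iota0 addr0.
    by rewrite rpredD ?rpredZ ?memv_span ?inE ?eqxx ?orbT.
  apply/eqP; rewrite eqEsubv subvf; apply/subvP => w _.
  by rewrite -[w]id_lfunE -projX memv_proj.
rewrite free_cons seq1_free span_seq1; apply/andP; split.
  apply/negP=> /vlineP[c /(congr1 F0)]; rewrite linearZ /= !F0E h00 h01.
  by rewrite scale1r scale0r scaler0 => /eqP; rewrite oner_eq0.
apply/eqP=> /(congr1 F1); rewrite F1E h11 linear0 scale1r => /eqP.
by rewrite oner_eq0.
Qed.

End ScalarExtension.

(** * The eigenspaces spanned by the points U_i *)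

Section Eigenspaces.
Variables (F : fieldType) (omega : F) (m : nat) (W : 'I_m -> vectType F).
Variables (TW : vectType F) (tens : (forall k, W k) -> TW).
Variables (f0 f1 : forall k, W k).
Hypotheses (two0 : 1 + 1 = 0 :> F) (omegaE : omega ^+ 2 + omega + 1 = 0).
Hypotheses (m_odd : odd m) (tensP : is_tensor_product tens).
Hypothesis f_basis : forall k, basis_of {:W k} [:: f0 k; f1 k].

Lemma omega2 : omega ^+ 2 = omega + 1.
Proof.
apply/eqP; rewrite -subr_eq0 -omegaE opprD -addrA.
have opp (x : F) : - x = x.
  by apply/eqP; rewrite eq_sym -addr_eq0 -[x]mul1r -mulrDl two0 mul0r.
by rewrite !opp.
Qed.

Lemma u_vec_span k (w : W k) : exists c0 c1,
  w = c0 *: u_vec omega f0 f1 false k + c1 *: u_vec omega f0 f1 true k.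
Proof.
have [c0 [c1 ->]] := basis2_expand w (f_basis k); rewrite /u_vec omega2.
(* The solution of the system x + y = c0, x omega + y (omega + 1) = c1. *)
exists (c0 * (omega + 1) + c1), (c0 * omega + c1).
rewrite !scalerDr !scalerA addrACA -!scalerDl.
congr (_ *: _ + _ *: _).
  transitivity (c0 + (1 + 1) * (c0 * omega + c1)); last by ring.
  by rewrite two0 mul0r addr0.
transitivity (c1 + (1 + 1) * (c0 * omega * (omega + 1) + c1 * omega)); last by ring.
by rewrite two0 mul0r addr0.
Qed.

Lemma u_vec_neq0 b k : u_vec omega f0 f1 b k != 0.
Proof.
have /andP[_] := f_basis k; rewrite free_cons seq1_free span_seq1 => /andP[f01 _].
apply: contraNneq f01; rewrite /u_vec => /eqP; rewrite addr_eq0 => /eqP ->.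
by rewrite rpredN memvZ ?memv_line.
Qed.

Let U i := U_vec tens omega f0 f1 i.

Lemma U_vec_neq0 i : U i != 0.
Proof. by apply: (tensor_neq0 tensP) => k; apply: u_vec_neq0. Qed.

Variable sigma : forall k, 'End(W k).
Hypotheses (sigma0 : forall k, sigma k (f0 k) = f1 k).
Hypotheses (sigma1 : forall k, sigma k (f1 k) = f0 k + f1 k).
Variable S : 'End(TW).
Hypothesis SE : forall a, S (tens a) = \sum_k tens (dfwith a (sigma k (a k))).

(** Both omega and omega^2 are roots z of z^2 = z + 1, and f0 + z f1 is an
    eigenvector of [sigma k] for each of them. *)
Lemma sigma_u_vec b k : sigma k (u_vec omega f0 f1 b k) =
  (omega + b%:R) *: u_vec omega f0 f1 b k.
Proof.
set z := if b then omega ^+ 2 else omega.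
have zE : omega + b%:R = z by rewrite /z; case: b {z}; rewrite ?omega2 ?addr0.
have z2 : z * z = 1 + z.
  (* The factor is 1 for z = omega and omega^2 - omega + 1 for z = omega^2. *)
  have zz : z ^+ 2 + z + 1 = (1 + b%:R * (omega ^+ 2 - omega)) * (omega ^+ 2 + omega + 1).
    by rewrite /z; case: b {z zE} => /=; ring.
  transitivity (z ^+ 2 + z + 1 - (1 + 1) * (z + 1) + 1 + z); last first.
    by rewrite zz omegaE two0 mulr0 mul0r subr0 add0r.
  by ring.
rewrite zE /u_vec -/z linearD linearZ /= sigma0 sigma1 !scalerDr scalerA z2.
by rewrite scalerDl scale1r addrCA.
Qed.

Lemma natr_odd n : n%:R = (odd n)%:R :> F.
Proof.
by rewrite -{1}[n]odd_double_half natrD -mul2n natrM mulr2n two0 mul0r addr0.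
Qed.

(** The eigenvalues omega + i_k of the factors add up to
    m omega + #{k | i_k = 1}, where m counts as 1 in characteristic 2 because
    it is odd. *)
Lemma S_U_vec (i : {ffun 'I_m -> bool}) :
  S (U i) = (omega + (odd #|[set k | i k]|)%:R) *: U i.
Proof.
have [tensL _] := tensP.
rewrite SE (eq_bigr (fun k => (omega + (i k)%:R) *: U i)) => [|k _].
  rewrite -scaler_suml big_split /= sumr_const card_ord -[omega *+ m]mulr_natr.
  rewrite (natr_odd m) m_odd mulr1 -natr_sum [(\sum_k _)%:R]natr_odd -sum1_card.
  congr ((_ + (odd _)%:R) *: _); rewrite [RHS]big_mkcond.
  by apply: eq_bigr => k _; rewrite inE; case: (i k).
by rewrite sigma_u_vec multilinearZ // dfwith_id.
Qed.

Let Ap := span_B_plus tens omega f0 f1.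
Let Am := span_B_minus tens omega f0 f1.

Lemma span_B_plus_sub w : w \in Ap -> S w = omega *: w.
Proof.
case/memv_sumP=> v vU ->; rewrite linear_sum scaler_sumr; apply: eq_bigr => i i_even.
have /vlineP[c ->] := vU i i_even.
by rewrite linearZ /= S_U_vec (negPf i_even) addr0 !scalerA mulrC.
Qed.

Lemma span_B_minus_sub w : w \in Am -> S w = omega ^+ 2 *: w.
Proof.
case/memv_sumP=> v vU ->; rewrite linear_sum scaler_sumr; apply: eq_bigr => i i_odd.
have /vlineP[c ->] := vU i i_odd.
by rewrite linearZ /= S_U_vec i_odd omega2 !scalerA mulrC.
Qed.

Lemma mem_U_vec i : U i \in if odd #|[set k | i k]| then Am else Ap.
Proof.
by rewrite memvE /Am /Ap /span_B_plus /span_B_minus; case: ifPn => i_par;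
   rewrite (sumv_sup i).
Qed.

Lemma span_B_full : (Ap + Am)%VS = fullv.
Proof.
apply: (tensor_span (B := fun k b => u_vec omega f0 f1 b k) tensP) => [k w|i].
  exact: u_vec_span.
have := mem_U_vec i; case: ifP => _; apply/subvP; first exact: addvSr.
exact: addvSl.
Qed.

Lemma eigen_decomposition w :
  exists x y, [/\ x \in Ap, y \in Am & w = x + y].
Proof.
have := memvf w; rewrite -span_B_full => /memv_addP[x xA [y yA ->]].
by exists x, y.
Qed.

(** The two spans lie in eigenspaces for different eigenvalues and together
    generate the whole space, so they are the full eigenspaces. *)
Lemma mem_span_B_plus w : w \in Ap <-> S w = omega *: w.
Proof.
split=> [|Sw]; first exact: span_B_plus_sub.
have [x [y [xA yA wE]]] := eigen_decomposition w; rewrite wE.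
move: Sw; rewrite wE linearD /= (span_B_plus_sub xA) (span_B_minus_sub yA).
rewrite scalerDr => /addrI /eqP; rewrite omega2 scalerDl scale1r -subr_eq0.
by rewrite addrAC subrr add0r => /eqP ->; rewrite addr0.
Qed.

Lemma mem_span_B_minus w : w \in Am <-> S w = omega ^+ 2 *: w.
Proof.
split=> [|Sw]; first exact: span_B_minus_sub.
have [x [y [xA yA wE]]] := eigen_decomposition w; rewrite wE.
move: Sw; rewrite wE linearD /= (span_B_plus_sub xA) (span_B_minus_sub yA).
rewrite scalerDr => /addIr /eqP; rewrite omega2 scalerDl scale1r eq_sym -subr_eq0.
by rewrite addrAC subrr add0r => /eqP ->; rewrite add0r.
Qed.

(** Both eigenvalues of [S] are roots of x^2 + x + 1. *)
Lemma S_quad w : S (S w) = S w + w.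
Proof.
have [x [y [/span_B_plus_sub Sx /span_B_minus_sub Sy ->]]] := eigen_decomposition w.
rewrite !linearD /= Sx Sy !linearZ /= Sx Sy !scalerA addrACA.
rewrite -{3}[x]scale1r -{3}[y]scale1r -!scalerDl -omega2 -!expr2.
congr (_ + _ *: y); rewrite omega2.
transitivity (omega + 1 + 1 + (1 + 1) * omega + (omega ^+ 2 - (omega + 1))).
  by ring.
by rewrite two0 mul0r addr0 omega2 subrr addr0.
Qed.

End Eigenspaces.

(** * Indicator sets from conjugate eigenspaces *)

Section QuadraticExtension.
Variables (F4 : fieldExtType 'F_2) (omega : F4).
Hypotheses (dimF4 : \dim {:F4} = 2%N) (omegaE : omega ^+ 2 + omega + 1 = 0).

Lemma F4_two0 : 1 + 1 = 0 :> F4.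
Proof. by apply: addvv. Qed.

Lemma F4_span (z : F4) : exists a b : 'F_2, z = a%:A + b%:A * omega.
Proof.
have om1 : omega \notin <[1 : F4]>%VS.
  apply/negP=> /mem_vline2[] om; move: omegaE; rewrite om.
    by rewrite expr0n /= !add0r => /eqP; rewrite oner_eq0.
  by rewrite expr1n F4_two0 add0r => /eqP; rewrite oner_eq0.
have full : (<[1 : F4]> + <[omega]>)%VS = fullv.
  by apply: line_sub_eq (subvf _) => //; apply: line_add; rewrite ?oner_eq0.
have := memvf z; rewrite -full => /memv_addP[_ /vlineP[a ->] [_ /vlineP[b ->] ->]].
by exists a, b; rewrite mulr_algl.
Qed.

Lemma F4_exp4 (z : F4) : (z ^+ 2) ^+ 2 = z.
Proof.
have om4 : (omega ^+ 2) ^+ 2 = omega.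
  have om2 := omega2 F4_two0 omegaE; rewrite om2.
  transitivity (omega ^+ 2 + 1 + (1 + 1) * omega); first by ring.
  by rewrite om2 F4_two0 mul0r addr0 -addrA F4_two0 addr0.
have sqrD (x y : F4) : (x + y) ^+ 2 = x ^+ 2 + y ^+ 2.
  transitivity (x ^+ 2 + y ^+ 2 + (1 + 1) * (x * y)); first by ring.
  by rewrite F4_two0 mul0r addr0.
have sqrA (a : 'F_2) : (a%:A : F4) ^+ 2 = a%:A.
  by have [->|->] := F2P a; rewrite ?scale0r ?scale1r ?expr0n ?expr1n.
have [a [b ->]] := F4_span z.
by rewrite sqrD exprMn !sqrA sqrD exprMn !sqrA om4.
Qed.

Variables (T : vectType 'F_2) (TW : vectType F4) (J : T -> TW) (conj : TW -> TW).
Hypothesis J_linear : linear_for (in_alg F4 \; *:%R) J.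
Hypothesis conjP : is_complex_conjugation J conj.
Hypothesis J_inj : injective J.
Hypothesis J_span : forall w, exists t1 t2, w = J t1 + omega *: J t2.

Let vv (w : TW) : w + w = 0 := addvv_char2 w F4_two0.
Let om2 : omega ^+ 2 = omega + 1 := omega2 F4_two0 omegaE.

Lemma JD t u : J (t + u) = J t + J u.
Proof. by have := J_linear 1 t u; rewrite /= !scale1r. Qed.

Lemma J0 : J 0 = 0.
Proof. by have := JD 0 0; rewrite addr0 vv. Qed.

Lemma conjJ t : conj (J t) = J t.
Proof. by case: conjP => _ ->. Qed.

Lemma conjD w x : conj (w + x) = conj w + conj x.
Proof. by case: conjP => /(_ 1 w x); rewrite expr1n !scale1r. Qed.

Lemma conj0 : conj 0 = 0.
Proof. by have := conjD 0 0; rewrite addr0 vv. Qed.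

Lemma conjZ c w : conj (c *: w) = c ^+ 2 *: conj w.
Proof. by case: conjP => /(_ c w 0); rewrite conj0 !addr0. Qed.

Lemma conjK : involutive conj.
Proof.
move=> w; have [t [u ->]] := J_span w.
by rewrite !(conjD, conjZ, conjJ) F4_exp4.
Qed.

(** Conjugation sends t + omega u to t + (omega + 1) u. *)
Lemma conj_fixed w : conj w = w -> exists t, w = J t.
Proof.
have [t [u ->]] := J_span w; rewrite conjD conjZ !conjJ om2 => /addrI.
rewrite scalerDl scale1r -[X in _ = X]addr0 => /addrI ->.
by exists t; rewrite scaler0 addr0.
Qed.

Variables (s : 'End(T)) (S : 'End(TW)).
Hypothesis sJ : forall t, J (s t) = S (J t).

Lemma S_conj w : S (conj w) = conj (S w).
Proof.
have [t [u ->]] := J_span w.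
by rewrite !(conjD, conjZ, conjJ, linearD, linearZ) /= -!sJ !conjJ.
Qed.

Hypothesis S_quad : forall w, S (S w) = S w + w.

Lemma descended_quad t : s (s t) = s t + t.
Proof. by apply: J_inj; rewrite JD !sJ S_quad. Qed.

Variables Ap Am : {vspace TW}.
Hypothesis mem_Ap : forall w, w \in Ap <-> S w = omega *: w.
Hypothesis mem_Am : forall w, w \in Am <-> S w = omega ^+ 2 *: w.

Lemma conj_Ap w : w \in Ap -> conj w \in Am.
Proof. by move/mem_Ap=> Sw; apply/mem_Am; rewrite S_conj Sw conjZ. Qed.

Lemma conj_Am w : w \in Am -> conj w \in Ap.
Proof.
by move/mem_Am=> Sw; apply/mem_Ap; rewrite S_conj Sw conjZ F4_exp4.
Qed.

Lemma eigen_skew : Defs.skew Ap Am.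
Proof.
apply/eqP; rewrite -subv0; apply/subvP => w; rewrite memv_cap memv0.
case/andP=> /mem_Ap Sw /mem_Am; rewrite Sw om2 scalerDl scale1r -[X in X = _]addr0.
by move/addrI=> <-.
Qed.

Lemma mem_conj_space (A : {vspace TW}) w : w \in A -> conj w \in conj_space conj A.
Proof. exact: (mem_semilinear_image (proj1 conjP) conj0). Qed.

Lemma conj_space_sub (A X : {vspace TW}) :
  (forall w, w \in A -> conj w \in X) -> (conj_space conj A <= X)%VS.
Proof. exact: semilinear_image_sub. Qed.

Lemma mem_complexify (A : {vspace T}) t : t \in A -> J t \in complexify J A.
Proof. exact: (mem_semilinear_image J_linear J0). Qed.

Lemma complexify_sub (A : {vspace T}) (X : {vspace TW}) :
  (forall t, t \in A -> J t \in X) -> (complexify J A <= X)%VS.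
Proof. exact: semilinear_image_sub. Qed.

Lemma conj_space_eq (A B : {vspace TW}) :
  (forall w, w \in A -> conj w \in B) -> (forall w, w \in B -> conj w \in A) ->
  conj_space conj A = B.
Proof.
move=> AB BA; apply/eqP; rewrite eqEsubv conj_space_sub //=.
by apply/subvP => w Bw; rewrite -[w]conjK mem_conj_space ?BA.
Qed.

Lemma conj_space_Ap : conj_space conj Ap = Am.
Proof. exact: conj_space_eq conj_Ap conj_Am. Qed.

Lemma conj_space_line x : conj_space conj <[x]> = <[conj x]>%VS.
Proof.
by apply: conj_space_eq => _ /vlineP[c ->]; rewrite conjZ ?conjK memvZ ?memv_line.
Qed.

(** For [x] in an eigenspace this is the real line that meets the two
    eigenspaces in [x] and [conj x]. *)
Definition conj_line x : {vspace TW} := (<[x]> + <[conj x]>)%VS.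

Lemma mem_conj_line x : (x \in conj_line x) * (conj x \in conj_line x).
Proof.
split; first by rewrite (subvP (addvSl _ _)) ?memv_line.
by rewrite (subvP (addvSr _ _)) ?memv_line.
Qed.

Lemma conj_neq0 x : x != 0 -> conj x != 0.
Proof. by apply: contra_neq => x0; rewrite -[x]conjK x0 conj0. Qed.

Lemma conj_line_line x : x \in Ap -> x != 0 -> line (conj_line x).
Proof.
move=> xA x0; apply: line_add => //; apply/negP=> /vlineP[c cx].
have : conj x \in (Ap :&: Am)%VS by rewrite memv_cap conj_Ap // cx memvZ.
by rewrite eigen_skew memv0 (negPf (conj_neq0 x0)).
Qed.

Lemma conj_line_real x : x \in Ap -> x != 0 -> real_line conj (conj_line x).
Proof.
move=> xA x0; split; first exact: conj_line_line.
have stable w : w \in conj_line x -> conj w \in conj_line x.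
  case/memv_addP=> _ /vlineP[c ->] [_ /vlineP[d ->] ->].
  by rewrite conjD !conjZ conjK rpredD ?rpredZ ?mem_conj_line.
exact: conj_space_eq.
Qed.

Lemma real_line_eq X x : real_line conj X -> x \in X -> x \in Ap -> x != 0 ->
  X = conj_line x.
Proof.
case=> lX cX xX xA x0; apply/esym/line_sub_eq => //; first exact: conj_line_line.
by rewrite subv_add -!memvE xX -cX mem_conj_space.
Qed.

(** As the eigenvalues are omega and omega + 1, the operator S + omega^2 is
    the projection onto the eigenspace of omega along the other one. *)
Definition plus_part t : TW := S (J t) + omega ^+ 2 *: J t.

Lemma conj_plus_part t : conj (plus_part t) = S (J t) + omega *: J t.
Proof. by rewrite conjD conjZ -sJ !conjJ F4_exp4. Qed.

Lemma plus_partE t : J t = plus_part t + conj (plus_part t).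
Proof.
rewrite conj_plus_part /plus_part addrACA vv add0r -scalerDl om2.
by rewrite addrAC (addvv omega) add0r scale1r.
Qed.

Lemma plus_part_mem t : plus_part t \in Ap.
Proof.
apply/mem_Ap; rewrite /plus_part linearD linearZ /= S_quad scalerDr scalerA.
have -> : omega * omega ^+ 2 = 1.
  transitivity ((omega - 1) * (omega ^+ 2 + omega + 1) + 1); first by ring.
  by rewrite omegaE mulr0 add0r.
rewrite scale1r addrAC -[X in X + _ + _]scale1r -scalerDl om2.
by rewrite addrCA F4_two0 addr0.
Qed.

Lemma plus_part_neq0 t : t != 0 -> plus_part t != 0.
Proof.
apply: contra_neq => x0; apply: J_inj.
by rewrite plus_partE x0 conj0 addr0 J0.
Qed.

(** Over F_4, the vectors [J t] and [J (s t)] span the same line as the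
    components of [J t] along the two eigenspaces. *)
Lemma complexify_quad_line t :
  complexify J (quad_line s t) = conj_line (plus_part t).
Proof.
set x := plus_part t; have [xl cxl] := mem_conj_line x.
have Jt : J t = x + conj x := plus_partE t.
have Jst : J (s t) = x + omega ^+ 2 *: J t.
  by rewrite sJ /x /plus_part -addrA vv addr0.
apply/eqP; rewrite eqEsubv; apply/andP; split.
  apply: complexify_sub => _ /memv_addP[_ /vlineP[a ->] [_ /vlineP[b ->] ->]].
  have Jl : J t \in conj_line x by rewrite Jt rpredD.
  have Jsl : J (s t) \in conj_line x by rewrite Jst rpredD ?rpredZ.
  by rewrite J_linear -[b *: _]addr0 J_linear J0 addr0 /= rpredD ?rpredZ.
have Jl : J t \in complexify J (quad_line s t).
  exact/mem_complexify/mem_quad_line.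
have Jsl : J (s t) \in complexify J (quad_line s t).
  apply/mem_complexify/quad_line_stable/mem_quad_line; exact: descended_quad.
rewrite subv_add -!memvE conj_plus_part /x /plus_part -sJ.
by rewrite !rpredD ?rpredZ.
Qed.

(** The vector x + conj x is fixed by conjugation, hence comes from some
    [t], whose component in the eigenspace of omega is [x]. *)
Lemma conj_line_descends x : x \in Ap -> x != 0 ->
  exists2 l, quad_spread s l & conj_line x = complexify J l.
Proof.
move=> xA x0; have [t Jt] : exists t, x + conj x = J t.
  by apply: conj_fixed; rewrite conjD conjK addrC.
have tx : plus_part t = x.
  rewrite /plus_part -Jt linearD scalerDr /=.
  move/mem_Ap: (xA) => ->; move/mem_Am: (conj_Ap xA) => ->.
  rewrite addrACA vv addr0 -scalerDl om2 addrA.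
  by rewrite (addvv omega) add0r scale1r.
exists (quad_line s t); last by rewrite complexify_quad_line tx.
exists t => //; apply: contra_neq x0 => t0.
by rewrite -tx /plus_part t0 J0 !linear0.
Qed.

Lemma real_line_meets X : real_line conj X -> meets X Am -> meets X Ap.
Proof.
case=> _ cX [_ [/pointP[x x0 ->]]]; rewrite -!memvE => xX xA.
have cxX : conj x \in X by rewrite -cX mem_conj_space.
exists <[conj x]>%VS; rewrite -!memvE conj_Am //.
by split=> //; apply/pointE/conj_neq0.
Qed.

Lemma spread_meets_Ap X : (exists2 l, quad_spread s l & X = complexify J l) <->
  (real_line conj X /\ meets X Ap).
Proof.
split=> [[_ [t t0 ->] ->] | [rX [_ [/pointP[x x0 ->]]]]].
  rewrite complexify_quad_line; have xA := plus_part_mem t.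
  have x0 := plus_part_neq0 t0; split; first exact: conj_line_real.
  exists <[plus_part t]>%VS; split; first exact: pointE.
    by rewrite -memvE mem_conj_line.
  by rewrite -memvE.
rewrite -!memvE => xX xA; rewrite (real_line_eq rX xX xA x0).
exact: conj_line_descends.
Qed.

Lemma spread_indicator_sets : indicator_sets J conj (quad_spread s) Ap Am.
Proof.
have meets_Am X : real_line conj X -> meets X Ap -> meets X Am.
  case=> _ cX [_ [/pointP[x x0 ->]]]; rewrite -!memvE => xX xA.
  have cxX : conj x \in X by rewrite -cX mem_conj_space.
  exists <[conj x]>%VS; rewrite -!memvE conj_Ap //.
  by split=> //; apply/pointE/conj_neq0.
split; [exact: eigen_skew | exact: conj_space_Ap | exact: spread_meets_Ap | |].
  move=> X; split=> [/spread_meets_Ap[rX XA] | [rX XA]].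
    by split=> //; apply: meets_Am.
  by apply/spread_meets_Ap; split=> //; apply: real_line_meets.
move=> _ [t t0 ->]; rewrite complexify_quad_line; set x := plus_part t.
have xA : x \in Ap := plus_part_mem t; have x0 : x != 0 := plus_part_neq0 t0.
exists <[x]>%VS; rewrite conj_space_line; split; first exact: pointE.
  rewrite /conj_line -vspace_modl -?memvE // (_ : _ :&: Ap = 0)%VS ?addv0 //.
  apply/eqP; rewrite -subv0 -eigen_skew [(Ap :&: _)%VS]capvC capvS //.
  by rewrite -memvE conj_Ap.
rewrite /conj_line addvC -vspace_modl -?memvE ?conj_Ap // (_ : _ :&: Am = 0)%VS ?addv0 //.
by apply/eqP; rewrite -subv0 -eigen_skew capvS // -memvE.
Qed.

End QuadraticExtension.

(** * Complexification of a tensor product *)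

Section TensorComplexification.
Variables (m : nat) (F4 : fieldExtType 'F_2) (omega : F4).
Hypotheses (dimF4 : \dim {:F4} = 2%N) (omegaE : omega ^+ 2 + omega + 1 = 0).
Variables (V : 'I_m -> vectType 'F_2) (W : 'I_m -> vectType F4).
Variable iota : forall k, V k -> W k.
Hypothesis iotaP : forall k, is_scalar_extension (@iota k).
Variables (TV : vectType 'F_2) (tensV : (forall k, V k) -> TV).
Variables (TW : vectType F4) (tensW : (forall k, W k) -> TW).
Hypotheses (tensVP : is_tensor_product tensV) (tensWP : is_tensor_product tensW).
Variable J : TV -> TW.
Hypothesis J_linear : linear_for (in_alg F4 \; *:%R) J.
Hypothesis J_tens : forall a : forall k, V k,
  J (tensV a) = tensW (fun k => iota (a k)).
Variables e0 e1 : forall k, V k.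
Hypothesis e_basis : forall k, basis_of {:V k} [:: e0 k; e1 k].

Let f0 k := iota (e0 k).
Let f1 k := iota (e1 k).

Lemma iota_basis k : basis_of {:W k} [:: f0 k; f1 k].
Proof. exact: scalar_extension_basis. Qed.

(** Tensors of basis vectors form a basis of [TV] that [J] maps to a basis of
    [TW]; the coordinates are [phi] and [psi].  This is what makes [TW] the
    scalar extension of [TV] along [J], which is only given on pure tensors. *)
Lemma complexification_coords :
  exists (E : {ffun 'I_m -> bool} -> TV)
         (phi : {ffun 'I_m -> bool} -> 'Hom(TV, ('F_2)^o))
         (psi : {ffun 'I_m -> bool} -> 'Hom(TW, F4^o)),
  [/\ forall t, t = \sum_i phi i t *: E i,
      forall w, w = \sum_i psi i w *: J (E i),
      forall i t, psi i (J t) = (phi i t)%:A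
    & forall i, exists a, E i = tensV a].
Proof.
have J0 := J0 J_linear.
have [phi [_ phiE]] := tensor_dual_basis tensVP e_basis.
have [psi [psi_dual psiE]] := tensor_dual_basis tensWP iota_basis.
pose E (i : {ffun 'I_m -> bool}) := tensV (fun k => if i k then e1 k else e0 k).
have JE i : J (E i) = tensW (fun k => if i k then f1 k else f0 k).
  rewrite J_tens; congr tensW; apply: functional_extensionality_dep => k.
  by case: (i k).
exists E, phi, psi; split=> // [w | i t | i].
- by rewrite {1}(psiE w); apply: eq_bigr => i _; rewrite JE.
- rewrite {1}(phiE t) (semilinear_sum J_linear) //= linear_sum (bigD1 i) //=.
  rewrite linearZ /= JE psi_dual eqxx -[X in X + _ = _]/(_ * _) mulr1.
  rewrite big1 ?addr0 // => j ji.
  by rewrite linearZ /= JE psi_dual eq_sym (negPf ji) scaler0.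
- by eexists.
Qed.

Lemma complexification_inj : injective J.
Proof.
have [E [phi [psi [phiE _ psiJ _]]]] := complexification_coords.
move=> t u tu; rewrite (phiE t) (phiE u); apply: eq_bigr => i _; congr (_ *: _).
by have := psiJ i t; rewrite tu psiJ => /(fmorph_inj (in_alg F4)).
Qed.

Lemma complexification_span w : exists t1 t2, w = J t1 + omega *: J t2.
Proof.
have [E [phi [psi [_ psiE _ _]]]] := complexification_coords.
have /fin_all_exists[a] := fun i => F4_span dimF4 omegaE (psi i w).
case/fin_all_exists=> b abE; have J0 := J0 J_linear.
exists (\sum_i a i *: E i), (\sum_i b i *: E i).
rewrite !(semilinear_sum J_linear) // {1}(psiE w) scaler_sumr -big_split /=.
by apply: eq_bigr => i _; rewrite abE scalerDl scalerA mulrC.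
Qed.

Lemma complexification_intertwines (s : 'End(TV)) (S : 'End(TW)) :
  (forall a, J (s (tensV a)) = S (J (tensV a))) -> forall t, J (s t) = S (J t).
Proof.
have [E [phi [psi [phiE _ _ E_pure]]]] := complexification_coords.
have J0 := J0 J_linear.
move=> eq_sS t; rewrite (phiE t) linear_sum /= (semilinear_sum J_linear) //.
rewrite linear_sum /= (eq_bigr (fun i => phi i t *: s (E i))) => [|i _]; last first.
  by rewrite linearZ.
rewrite (semilinear_sum J_linear) //; apply: eq_bigr => i _.
by rewrite linearZ /=; have [a ->] := E_pure i; rewrite eq_sS.
Qed.

Variable conj : TW -> TW.
Hypothesis conjP : is_complex_conjugation J conj.

Let U := U_vec tensW omega f0 f1.

(** Conjugation acts factor by factor: if [c k] is the conjugation of [W k],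
    then [a |-> conj (tensW (c a))] is linear in each entry, the two Frobenius
    maps cancelling, and agrees with [tensW] on the real basis vectors.  The
    conjugation of [W k] exchanges [u_0] and [u_1]. *)
Lemma conj_U_vec i : conj (U i) = U (opposite i).
Proof.
have conjK := conjK dimF4 omegaE conjP complexification_span.
have exp4 := F4_exp4 dimF4 omegaE.
have [tensL _] := tensWP.
have /fin_all_exists[c /all_and3[c_semi c0 c1]] : forall k, exists c : W k -> W k,
    [/\ forall z x y, c (z *: x + y) = z ^+ 2 *: c x + c y,
        c (f0 k) = f0 k & c (f1 k) = f1 k].
  move=> k; have [d0 [d00 d01]] := hom_of_basis (1 : F4^o) 0 (iota_basis k).
  have [d1 [d10 d11]] := hom_of_basis (0 : F4^o) 1 (iota_basis k).
  exists (fun w => d0 w ^+ 2 *: f0 k + d1 w ^+ 2 *: f1 k).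
  rewrite d00 d01 d10 d11 !expr0n !expr1n !scale1r !scale0r add0r addr0.
  split=> // z x y; rewrite (linearP d0) (linearP d1) /= scalerDr !scalerA.
  rewrite addrACA -!scalerDl.
  have sqr (x' y' : F4) : (z * x' + y') ^+ 2 = z ^+ 2 * x' ^+ 2 + y' ^+ 2.
    transitivity (z ^+ 2 * x' ^+ 2 + y' ^+ 2 + (1 + 1) * (z * x' * y')).
      by ring.
    by rewrite F4_two0 mul0r addr0.
  by rewrite -!sqr.
have tens_conj a : conj (tensW (fun k => c k (a k))) = tensW a.
  apply: (multilinear_ext (B := fun k b => if b then f1 k else f0 k)
           (f := fun a => conj (tensW (fun k => c k (a k)))) _ _ tensL _ a).
  - by move=> k v; apply: basis2_expand (iota_basis k).
  - move=> b k z x y; have cE v : (fun j => c j (dfwith b (v : W k) j)) =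
        dfwith (fun j => c j (b j)) (c k v).
      apply: functional_extensionality_dep => j.
      by have [<-|kj] := eqVneq k j; rewrite ?dfwith_in ?dfwith_out.
    by rewrite !cE c_semi tensL (proj1 conjP) exp4.
  - move=> j /=; pose d k := if j k then e1 k else e0 k.
    have cf : (fun k => c k (if j k then f1 k else f0 k)) =
              (fun k => if j k then f1 k else f0 k).
      by apply: functional_extensionality_dep => k; case: (j k).
    have dE : (fun k => if j k then f1 k else f0 k) = (fun k => iota (d k)).
      by apply: functional_extensionality_dep => k; rewrite /d; case: (j k).
    by rewrite cf dE -J_tens (proj2 conjP).
rewrite -[RHS]tens_conj; congr (conj (tensW _)).
apply: functional_extensionality_dep => k.

rewrite ffunE /u_vec addrC [in RHS]addrC c_semi c0 c1.
by case: (i k) => //=; rewrite exp4.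
Qed.
End TensorComplexification.

(** * The invariant spread *)

Theorem corollary1
  (m : nat) (m_ge1 : (1 <= m)%N) (m_odd : odd m)
  (F4 : fieldExtType 'F_2) (dimF4 : \dim {: F4} = 2%N)
  (omega : F4) (omegaE : omega ^+ 2 + omega + 1 = 0)
  (V : 'I_m -> vectType 'F_2) (dimV : forall k, \dim {: V k} = 2%N)
  (W : 'I_m -> vectType F4) (iota : forall k, V k -> W k)
  (iotaP : forall k, is_scalar_extension (iota k))
  (TV : vectType 'F_2) (tensV : (forall k, V k) -> TV)
  (tensVP : is_tensor_product tensV)
  (TW : vectType F4) (tensW : (forall k, W k) -> TW)
  (tensWP : is_tensor_product tensW)
  (J : TV -> TW) (J_linear : linear_for (in_alg F4 \; *:%R) J)
  (J_tens : forall a : forall k, V k,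
     J (tensV a) = tensW (fun k => iota k (a k)))
  (conj : TW -> TW) (conjP : is_complex_conjugation J conj)
  (e0 e1 : forall k, V k)
  (e_basis : forall k, basis_of {: V k} [:: e0 k; e1 k]) :
  let f0 := fun k => iota k (e0 k) in
  let f1 := fun k => iota k (e1 k) in
  let U := U_vec tensW omega f0 f1 in
  exists Ls : {vspace TV} -> Prop,
    [/\ geometric_line_spread Ls,
        forall phi, segre_group tensV phi -> forall l, Ls l <-> Ls (phi l),
        indicator_sets J conj Ls
          (span_B_plus tensW omega f0 f1) (span_B_minus tensW omega f0 f1),
        forall l, distinguished_tangent tensV l -> Ls l
      & forall i : {ffun 'I_m -> bool},
          (forall k : 'I_m, val k = 0%N -> i k = false) ->
          exists2 l, Ls l &
            (<[U i]> + <[U (opposite i)]>)%VS = complexify J l].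
Proof.
move=> f0 f1 U.
have f_basis k : basis_of {:W k} [:: f0 k; f1 k] :=
  scalar_extension_basis (iotaP k) (e_basis k).
have two0 : 1 + 1 = 0 :> F4 := F4_two0 F4.
have J_inj : injective J :=
  complexification_inj iotaP tensVP tensWP J_linear J_tens e_basis.
have J_span : forall w, exists t1 t2, w = J t1 + omega *: J t2 :=
  complexification_span dimF4 omegaE iotaP tensVP tensWP J_linear J_tens e_basis.
have [sigma /all_and2[sigma0 sigma1]] :=
  fin_all_exists (fun k => hom_of_basis (e1 k) (e0 k + e1 k) (e_basis k)).
have [sigmaW /all_and2[sigmaW0 sigmaW1]] :=
  fin_all_exists (fun k => hom_of_basis (f1 k) (f0 k + f1 k) (f_basis k)).
have sigma_quad k v : sigma k (sigma k v) = sigma k v + v.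
  have [a [b ->]] := basis2_expand v (e_basis k).
  rewrite !(linearD, linearZ) /= sigma0 sigma1 !(linearD, linearZ) /= sigma0 sigma1.
  by rewrite !scalerDr addrACA [in RHS]addrC addrACA; congr (_ + _); rewrite addrC.
have sigma_iota k v : iota k (sigma k v) = sigmaW k (iota k v).
  have [a [b ->]] := basis2_expand v (e_basis k).
  have [iL _] := iotaP k; have i0 : iota k 0 = 0.
    by have := iL 1 0 0; rewrite /= !scale1r addr0 -{1}[iota k 0]addr0 => /addrI.
  have iD x y : iota k (x + y) = iota k x + iota k y.
    by have := iL 1 x y; rewrite /= !scale1r.
  have iZ c x : iota k (c *: x) = c%:A *: iota k x.
    by have := iL c x 0; rewrite /= i0 !addr0.
  by rewrite !(linearD, linearZ, iD, iZ) /= sigma0 sigma1 sigmaW0 sigmaW1 !iD.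
have [s sE] := tensor_derivation tensVP sigma.
have [S SE] := tensor_derivation tensWP sigmaW.
have sJ : forall t, J (s t) = S (J t).
  apply: (complexification_intertwines iotaP tensVP tensWP J_linear J_tens e_basis).
  move=> a; rewrite sE J_tens SE.
  rewrite (big_morph J (JD J_linear) (J0 J_linear)).
  apply: eq_bigr => k _; rewrite J_tens; congr tensW.
  apply: functional_extensionality_dep => j.
  have [<-|kj] := eqVneq k j; first by rewrite !dfwith_in sigma_iota.
  by rewrite !dfwith_out.
have Sq := S_quad two0 omegaE m_odd tensWP f_basis sigmaW0 sigmaW1 SE.
have s_quad := descended_quad J_linear J_inj sJ Sq.
have ApP := mem_span_B_plus two0 omegaE m_odd tensWP f_basis sigmaW0 sigmaW1 SE.
have AmP := mem_span_B_minus two0 omegaE m_odd tensWP f_basis sigmaW0 sigmaW1 SE.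
exists (quad_spread s); split.
- exact: quad_spread_geometric.
- by move=> phi phiG l; apply: (segre_group_quad_spread dimV tensVP sigma_quad sE).
- exact: (spread_indicator_sets dimF4 omegaE J_linear conjP J_inj J_span sJ Sq ApP AmP).
- move=> l [a a0 /(distinguished_tangentE dimV tensVP sigma_quad sE s_quad a0) ->].
  by exists (tensV a) => //; apply: (tensor_neq0 tensVP).
move=> i _; have U0 j : U j != 0 .
  exact: U_vec_neq0.
have conjU j : conj (U j) = U (opposite j).
  exact: (conj_U_vec dimF4 omegaE iotaP tensVP tensWP J_linear J_tens e_basis conjP).
have descend := conj_line_descends dimF4 omegaE J_linear conjP J_inj J_span sJ Sq ApP AmP.
have := @mem_U_vec F4 omega m W TW tensW f0 f1 i; rewrite -/(U i) -conjU.
case: ifP => _ UA; last exact: descend.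
rewrite addvC -{2}[U i](conjK dimF4 omegaE conjP J_span).
apply: descend; last exact: (conj_neq0 dimF4 omegaE conjP J_span (U0 i)).
exact: (conj_Am dimF4 omegaE conjP J_span sJ ApP AmP).
Qed.
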